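(* Let $X$ and $Y$ be oriented labeled polyhedral cell complexes (with labels monomials in $\mathbb C[z_1,\dots,z_n]$) such that $X$ refines $Y$ as labeled polyhedral cell complexes, and let $E_\bullet,\varphi_\bullet$ and $F_\bullet,\psi_\bullet$ be the vector bundle complexes over $\mathbb C^n$ corresponding to $X$ and $Y$, respectively. For $k\ge-1$ let $a_k:F_k\to E_k$ be the mapping $$a_k:e_\sigma\mapsto\sum_{\sigma'\subset\sigma}\mathrm{sgn}(\sigma',\sigma)\frac{m_\sigma}{m_{\sigma'}}e_{\sigma'},$$ where, for $\sigma\in Y_k$, the sum is over all $\sigma'\in X_k$ that satisfy $\sigma'\subset\sigma$. Then the $a_k$ are holomorphic and they form a morphism of complexes, i.e. $a_{k-1}\circ\psi_k=\varphi_k\circ a_k$ for all $k\ge0$.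
   Context: **Labeled polyhedral cell complexes.** A polyhedral cell complex $X$ is a finite collection of convex polytopes (its faces, including $\emptyset$) in a Euclidean space, closed under taking faces, such that any two members intersect in a common face of both. $X_k$ is the set of $k$-dimensional faces, $X_{-1}=\{\emptyset\}$; $|X|$ is the union of the faces. A facet of a $k$-dimensional face is a face of it of dimension $k-1$. $X$ is labeled if each vertex carries a monomial in $\mathbb C[z_1,\dots,z_n]$; a face $\sigma$ is then labeled by the least common multiple $m_\sigma$ of the labels of its vertices, and $m_\emptyset=1$. For labeled complexes $X,Y$, $X$ refines $Y$ if $|X|=|Y|$, each face of $Y$ is a union of faces of $X$, and $m_{\sigma'}\mid m_\sigma$ whenever $\sigma'\in X$, $\sigma\in Y$, $\sigma'\subset\sigma$. **Orientation.** For a polytope $\sigma$, $\mathrm{span}\,\sigma$ is the vector space underlying its affine hull. An oriented polytope is a polytope with an orientation of $\mathrm{span}\,\sigma$ (a unique one in dimension $\le 0$). A complex is oriented if each of its faces is. For a facet $\tau$ of a $k$-dimensional $\sigma$, let $\eta$ be a normal vector to the affine hull of $\tau$ in the affine hull of $\sigma$, pointing towards $\sigma$. For $k\ge2$ put $\mathrm{sgn}(\tau,\sigma)=1$ if, for a positively oriented basis $w_1,\dots,w_{k-1}$ of $\mathrm{span}\,\tau$, the basis $\eta,w_1,\dots,w_{k-1}$ of $\mathrm{span}\,\sigma$ is positively oriented, and $-1$ otherwise; for $k=1$ it is $1$ if $\eta$ is positively oriented and $-1$ otherwise; for $k=0$ it is $1$. For oriented polytopes $\sigma'\subset\sigma$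 of the same dimension $k$, $\mathrm{sgn}(\sigma',\sigma)=1$ if they induce the same orientation on $\mathrm{span}\,\sigma'=\mathrm{span}\,\sigma$, and $-1$ otherwise ($=1$ if $k\le0$). **Associated bundle complex.** For an oriented labeled polyhedral cell complex $X$, $E_k$ ($-1\le k\le\dim X$) is the trivial vector bundle over $\mathbb C^n$ with global frame $\{e_\sigma\}_{\sigma\in X_k}$, and $$\varphi_k:E_k\to E_{k-1},\qquad\varphi_ke_\sigma=\sum_{\tau\text{ facet of }\sigma}\mathrm{sgn}(\tau,\sigma)\frac{m_\sigma}{m_\tau}e_\tau .$$ $F_\bullet,\psi_\bullet$ is defined in the same way from $Y$. *)

(* Defs.v *)
From HB Require Import structures.
From mathcomp Require Import all_boot all_order all_algebra finmap complex.
From mathcomp Require Import all_classical all_reals all_analysis.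
From mathcomp Require mpoly.
Set Implicit Arguments.
Unset Strict Implicit.
Unset Printing Implicit Defensive.
Import Order.TTheory GRing.Theory Num.Theory.
Import numFieldNormedType.Exports.

Local Open Scope classical_set_scope.
Local Open Scope ring_scope.

Section Polytopes.
Variables (R : realType) (d : nat).
Local Notation V := 'rV[R]_d.
Implicit Types (P Q F : set V) (U : {vspace V}) (b : seq V).

Definition dotv (u v : V) : R := \sum_i u 0 i * v 0 i.

Definition conv_hull (s : seq V) : set V :=
  [set x | exists c : 'I_(size s) -> R,
     [/\ forall i, 0 <= c i, \sum_i c i = 1 & x = \sum_i c i *: s`_i]].

(* The empty polytope is the convex hull of the empty sequence. *)
Definition polytope P : Prop := exists s : seq V, P = conv_hull s.

(* [l = 0] gives the two improper faces [P] ([c = 0]) and [set0] ([c = 1]). *)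
Definition is_face F P : Prop :=
  exists (l : V) (c : R), (forall x, P x -> dotv l x <= c) /\
    F = P `&` [set x | dotv l x = c].

Definition aff_hull P : set V :=
  [set x | exists (m : nat) (p : 'I_m -> V) (c : 'I_m -> R),
     [/\ forall i, P (p i), \sum_i c i = 1 & x = \sum_i c i *: p i]].

Definition aff_dir P : set V :=
  [set v | exists x y, [/\ aff_hull P x, aff_hull P y & v = x - y]].

(* [spanv P] is the subspace [aff_dir P] (see [mem_spanv]) when [P] is
   nonempty, and [0] when [P] is empty. *)
Definition spanv P : {vspace V} :=
  xget 0%VS [set U : {vspace V} | forall v, v \in U <-> aff_dir P v].

Lemma aff_hull_shift P a x y z :
  aff_hull P x -> aff_hull P y -> aff_hull P z -> aff_hull P (z + a *: (x - y)).
Proof.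
move=> [m1 [p1 [c1 [h1 s1 ->]]]] [m2 [p2 [c2 [h2 s2 ->]]]].
move=> [m3 [p3 [c3 [h3 s3 ->]]]].
pose G T (f1 : 'I_m1 -> T) (f2 : 'I_m2 -> T) (f3 : 'I_m3 -> T)
    (i : 'I_(m3 + (m1 + m2))) :=
  match fintype.split i with inl j => f3 j | inr j =>
    match fintype.split j with inl k => f1 k | inr k => f2 k end end.
exists (m3 + (m1 + m2))%N, (G _ p1 p2 p3),
  (G R (fun i => a * c1 i) (fun i => - (a * c2 i)) c3).
have spl k l (j : 'I_k) : fintype.split (lshift l j) = inl j.
  by rewrite -[lshift _ _]/(unsplit (inl j)) unsplitK.
have spr k l (j : 'I_l) : fintype.split (rshift k j) = inr j.
  by rewrite -[rshift _ _]/(unsplit (inr j)) unsplitK.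
split.
- by move=> i; rewrite /G; case: (fintype.split i) => // j; case: (fintype.split j).
- rewrite !big_split_ord /= /G.
  under eq_bigr do rewrite spl.
  under [X in _ + (X + _)]eq_bigr do rewrite spr spl.
  under [X in _ + (_ + X)]eq_bigr do rewrite spr spr.
  by rewrite sumrN -!mulr_sumr s1 s2 s3 mulr1 subrr addr0.
- rewrite !big_split_ord /= /G.
  under [in RHS]eq_bigr do rewrite !spl.
  under [X in _ = _ + (X + _)]eq_bigr do rewrite !spr !spl -scalerA.
  under [X in _ = _ + (_ + X)]eq_bigr do rewrite !spr scaleNr -scalerA.
  by rewrite sumrN -!scaler_sumr scalerBr.
Qed.

Lemma mem_spanv P v : P !=set0 -> v \in spanv P <-> aff_dir P v.
Proof.
move=> [p Pp]; have hp : aff_hull P p.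
  by exists 1%N, (fun=> p), (fun=> 1); split=> //; rewrite big_ord1 ?scale1r.
have D0 : aff_dir P 0 by exists p, p; rewrite subrr.
have DL a u w : aff_dir P u -> aff_dir P w -> aff_dir P (w + a *: u).
  move=> [x [y [hx hy ->]]] [x' [y' [hx' hy' ->]]].
  exists (x' + a *: (x - y)), y'; split=> //; last by rewrite addrAC.
  exact: aff_hull_shift.
suff [U UP] : exists U : {vspace V}, forall v, v \in U <-> aff_dir P v.
  rewrite /spanv; by case: xgetP => [W _ ->|/(_ U)/(_ UP)].
pose q k := `[< exists U : {vspace V},
  (forall v, v \in U -> aff_dir P v) /\ \dim U = k >].
have q0 : exists k, q k.
  exists 0%N; apply/asboolP; exists 0%VS; split; last exact: dimv0.
  by move=> w; rewrite memv0 => /eqP ->.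
have qb k : q k -> (k <= \dim {:V})%N.
  by move=> /asboolP[U [_ <-]]; apply: dimvS; apply: subvf.
case: (ex_maxnP q0 qb) => k /asboolP[U [UD dU]] kmax.
exists U => w; split=> [/UD//|Dw].
have qU : q (\dim (U + <[w]>)).
  apply/asboolP; exists (U + <[w]>)%VS; split=> // u.
  move=> /memv_addP[u1 u1U [u2 /vlineP[a ->] ->]].
  exact: DL (UD _ u1U).
have : (U + <[w]> == U)%VS.
  by rewrite eq_sym eqEdim addvSl /= dU; exact: kmax.
by move=> /eqP <-; exact: (subvP (addvSr _ _) _ (memv_line w)).
Qed.

Definition pdim P : int := if P == set0 then -1 else (\dim (spanv P))%:Z.

Definition is_facet F P : Prop := is_face F P /\ pdim F = pdim P - 1.

Definition change_basis b b' : 'M[R]_(size b) :=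
  \matrix_(i, j) coord (in_tuple b) j b'`_i.

(* An orientation of [U] is given by the set of its positively oriented ordered
   bases; for [U = 0] the only choice is [[set [::]]]. *)
Definition is_orientation U (o : set (seq V)) : Prop :=
  [/\ forall b, o b -> basis_of U b,
      exists b, o b
    & forall b b', o b -> basis_of U b' -> (o b' <-> 0 < \det (change_basis b b'))].

Definition inward_normal F P (eta : V) : Prop :=
  [/\ eta != 0, eta \in spanv P,
      forall w, w \in spanv F -> dotv eta w = 0
    & forall x y, P x -> F y -> 0 <= dotv eta (x - y)].

Definition sgn_facet F (oF : set (seq V)) P (oP : set (seq V)) : int :=
  if pdim P <= 0 then 1
  else if pdim P == 1 then
    if `[< exists2 eta, inward_normal F P eta & oP [:: eta] >] then 1 else -1
  else
    if `[< exists eta w, [/\ inward_normal F P eta, oF w & oP (eta :: w)] >]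
    then 1 else -1.

Definition sgn_sub P (oQ : set (seq V)) (oP : set (seq V)) : int :=
  if pdim P <= 0 then 1 else if `[< oQ = oP >] then 1 else -1.

End Polytopes.

Section Complexes.
Variables (R : realType) (d n : nat).
Local Notation V := 'rV[R]_d.

Record cell_complex := CellComplex {
  faces :> {fset set V};
  face_polytope : forall P, P \in faces -> polytope P;
  face_set0 : set0 \in faces;
  face_closed : forall P F, P \in faces -> is_face F P -> F \in faces;
  face_inter : forall P Q, P \in faces -> Q \in faces ->
    is_face (P `&` Q) P /\ is_face (P `&` Q) Q }.

Definition kfaces (X : cell_complex) (k : int) : finType :=
  {s : faces X | pdim (val s) == k}.

Definition pset (X : cell_complex) (k : int) (s : kfaces X k) : set V :=
  val (val s).

Definition realization (X : cell_complex) : set V :=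
  \bigcup_(P in [set` faces X]) P.

(* A monomial in [n] variables is given by its multi-exponent. *)
Record labeled_complex := LabeledComplex {
  lcomplex :> cell_complex;
  vlabel : kfaces lcomplex 0 -> mpoly.multinom n }.

Definition flabel (X : labeled_complex) (P : set V) : mpoly.multinom n :=
  \big[@mpoly.mlcm n/@mpoly.mnm0 n]_(v : kfaces X 0 | `[< is_face (pset v) P >])
     vlabel v.

Definition refines (X Y : labeled_complex) : Prop :=
  [/\ realization X = realization Y,
      forall Q, Q \in faces Y -> exists2 A : set (set V),
        A `<=` [set` faces X] & Q = \bigcup_(P in A) P
    & forall P Q, P \in faces X -> Q \in faces Y -> P `<=` Q ->
        mpoly.lem (flabel X P) (flabel Y Q)].

Record oriented_labeled_complex := OrientedLabeledComplex {
  olcomplex :> labeled_complex;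
  orient : faces olcomplex -> set (seq V);
  orientP : forall s, is_orientation (spanv (val s)) (orient s) }.

End Complexes.

Section Bundles.
Variables (R : realType) (n : nat).
Local Notation C := R[i].

(* The trivial bundle over [C^n] with global frame indexed by [I] is represented
   by its fiber, with [frame i] the constant sections of the frame; a bundle map
   is represented by its action on the fibers. *)
Definition fiber (I : finType) := {ffun I -> C^o}.

Definition frame (I : finType) (i : I) : fiber I := [ffun j => (i == j)%:R].

Definition bundle_map (I J : finType) := 'rV[C]_n -> 'Hom(fiber I, fiber J).

Definition frame_map (I J : finType) (a : I -> 'rV[C]_n -> fiber J) :
    bundle_map I J :=
  fun z => linfun (fun f : fiber I => \sum_i (f i : C) *: a i z).

Lemma frame_mapE (I J : finType) (a : I -> 'rV[C]_n -> fiber J) z i :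
  frame_map a z (frame i) = a i z.
Proof.
have lin : linear (fun f : fiber I => \sum_i (f i : C) *: a i z).
  move=> c f g; rewrite scaler_sumr -big_split /=; apply: eq_bigr => j _.
  by rewrite !ffunE scalerDl scalerA.
pose L := GRing.isLinear.Build C (fiber I) (fiber J) *:%R _ lin.
pose h : {linear fiber I -> fiber J} := HB.pack (fun f : fiber I => \sum_i (f i : C) *: a i z) L.
rewrite /frame_map -[X in linfun X]/(h : _ -> _) lfunE /=.
rewrite (bigD1 i) //= big1 ?addr0 ?ffunE ?eqxx ?scale1r // => j ji.
by rewrite ffunE eq_sym (negPf ji) scale0r.
Qed.

Definition holomorphic (f : 'rV[C]_n -> C) : Prop :=
  forall z, differentiable (f : 'rV[C]_n -> C^o) z.

Definition holomorphic_map (I J : finType) (a : bundle_map I J) : Prop :=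
  forall i j, holomorphic (fun z => a z (frame i) j).

(* Meant for [m'] dividing [m], where it is the polynomial function [m / m']. *)
Definition mquot (m m' : mpoly.multinom n) (z : 'rV[C]_n) : C :=
  mpoly.meval (fun i => z 0 i) (mpoly.mpolyX C (mpoly.mnm_sub m m')).

End Bundles.

Section BundleComplex.
Variables (R : realType) (d n : nat).
Implicit Types (X Y : oriented_labeled_complex R d n) (k : int).

Definition boundary X k : bundle_map R n (kfaces X k) (kfaces X (k - 1)) :=
  frame_map (fun s z =>
    \sum_(t : kfaces X (k - 1) | `[< is_facet (pset t) (pset s) >])
      ((sgn_facet (pset t) (orient (val t)) (pset s) (orient (val s)))%:~R
        * mquot (flabel X (pset s)) (flabel X (pset t)) z) *: frame R t).

Definition refinement_map X Y k : bundle_map R n (kfaces Y k) (kfaces X k) :=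
  frame_map (fun s z =>
    \sum_(s' : kfaces X k | `[< pset s' `<=` pset s >])
      ((sgn_sub (pset s) (orient (val s')) (orient (val s)))%:~R
        * mquot (flabel Y (pset s)) (flabel X (pset s')) z) *: frame R s').

End BundleComplex.

(* Main.v *)
(* A cell [F] of [X] of dimension [k - 1] inside a face [Q] of [Y] of dimension [k] >= 1
   spans a hyperplane of the span of [Q]; let [e] be a normal of it and [w] a basis of
   the span of [F].  A cell of [X] in [Q] having [F] as a facet contributes the sign
   osgn (orientation of F) w * osgn (orientation of Q) (e' :: w) to the coefficient of
   [F], where [e'] in {e, -e} is its inward normal: the orientation of the cell itself
   cancels.  There is exactly one such cell on each side of the hyperplane on which [Q]
   has points.  If [Q] has points on both sides, the two contributions cancel and [F]
   lies in no facet of [Q]; otherwise the hyperplane cuts out the only facet of [Q]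
   containing [F], and it contributes the same sign. *)
Require Import Defs.
From HB Require Import structures.
From mathcomp Require Import all_boot all_order all_algebra finmap complex.
From mathcomp Require Import all_classical all_reals all_analysis.
From mathcomp Require mpoly.
From mathcomp Require Import zify ring lra.
Set Implicit Arguments.
Unset Strict Implicit.
Unset Printing Implicit Defensive.
Import Order.TTheory GRing.Theory Num.Theory.
Import numFieldNormedType.Exports.
Import (coercions) mpoly.
Import Defs.
Local Open Scope classical_set_scope.
Local Open Scope ring_scope.

(** * The dot product and normals to subspaces *)

Section DotProduct.
Variables (R : realType) (d : nat).
Local Notation V := 'rV[R]_d.
Implicit Types (U W : {vspace V}) (u v w x y e : V).

Lemma dotvC u v : dotv u v = dotv v u.
Proof. by apply: eq_bigr => i _; rewrite mulrC. Qed.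

Lemma dotvDr u v w : dotv u (v + w) = dotv u v + dotv u w.
Proof. by rewrite -big_split; apply: eq_bigr => i _; rewrite mxE mulrDr. Qed.

Lemma dotvZr u a v : dotv u (a *: v) = a * dotv u v.
Proof. by rewrite mulr_sumr; apply: eq_bigr => i _; rewrite mxE mulrCA. Qed.

Lemma dotvNr u v : dotv u (- v) = - dotv u v.
Proof. by rewrite -scaleN1r dotvZr mulN1r. Qed.

Lemma dotvBr u v w : dotv u (v - w) = dotv u v - dotv u w.
Proof. by rewrite dotvDr dotvNr. Qed.

Lemma dotvNl u v : dotv (- u) v = - dotv u v.
Proof. by rewrite dotvC dotvNr dotvC. Qed.

Lemma dotv0l u : dotv 0 u = 0.
Proof. by apply: big1 => i _; rewrite mxE mul0r. Qed.

Lemma dotvv_gt0 u : u != 0 -> 0 < dotv u u.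
Proof.
move=> u0; rewrite lt_def sumr_ge0 ?andbT => [|i _]; last by rewrite -expr2 sqr_ge0.
apply: contraNneq u0 => /psumr_eq0P u0; apply/eqP/rowP => i; rewrite mxE.
by apply/eqP; rewrite -sqrf_eq0 expr2 u0 // => j _; rewrite -expr2 sqr_ge0.
Qed.

(** Pairing with a basis of [U] is a linear map [f] into a space of dimension [\dim U], so by rank
    and nullity its kernel meets the larger space [W] nontrivially. *)
Lemma exists_normal U W : (\dim U < \dim W)%N ->
  exists e, [/\ e != 0, e \in W & forall u, u \in U -> dotv e u = 0].
Proof.
move=> dUW; pose A : 'M[R]_(d, \dim U) := \matrix_(i, j) (vbasis U)`_j 0 i.
pose f : 'Hom(V, 'rV[R]_(\dim U)) := linfun (mulmxr A).
have : (W :&: lker f)%VS != 0%VS.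
  rewrite -dimv_eq0 -lt0n; have fW := limg_ker_dim f W.
  have : (\dim (f @: W) <= \dim U)%N.
    by rewrite (leq_trans (dimvS (subvf _))) // dimvf dim_matrix -[(_ * _)%R]/(1 * _)%N mul1n.
  by apply: contraLR; rewrite -leqNgt leqn0 => /eqP W0; move: fW; rewrite W0 -ltnNge add0n => ->.
move=> /eqP Wf0; pose e := vpick (W :&: lker f).
have : e \in (W :&: lker f)%VS by exact: memv_pick.
rewrite memv_cap memv_ker => /andP[eW /eqP]; rewrite lfunE /= => eA.
exists e; split=> // [|u uU]; first by rewrite vpick0; apply/eqP.
rewrite (coord_vbasis uU).
elim/big_ind : _ => [|v w hv hw|i _].
- by rewrite dotvC dotv0l.
- by rewrite dotvDr hv hw addr0.
- rewrite dotvZr.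
  have /rowP/(_ i) := eA; rewrite !mxE => ei; rewrite /dotv.
  under eq_bigr => j _ do [rewrite (_ : (vbasis U)`_i 0 j = A j i); last by rewrite mxE].
  by rewrite ei mulr0.
Qed.

Lemma normal_notin U e : e != 0 -> (forall u, u \in U -> dotv e u = 0) -> e \notin U.
Proof. by move=> e0 eU; apply: contraTN (dotvv_gt0 e0) => /eU ->; rewrite ltxx. Qed.

(** By dimension [W] is the sum of [U] and the line of [e], and [dotv e] reads off the component
    along [e]. *)
Lemma hyperplane_mem U W e w : (U <= W)%VS -> \dim W = (\dim U).+1 ->
  e \in W -> e != 0 -> (forall u, u \in U -> dotv e u = 0) ->
  w \in W -> dotv e w = 0 -> w \in U.
Proof.
move=> UW dW eW e0 eU wW ew.
have e_notin := normal_notin e0 eU.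
have UeW : (U + <[e]>)%VS = W.
  apply/eqP; rewrite eqEdim subv_add UW -memvE eW /= dW.
  rewrite dimv_disjoint_sum ?dim_vline ?e0 ?addn1 //.
  apply/eqP; rewrite -subv0; apply/subvP => v /memv_capP[vU /vlineP[a va]].
  rewrite memv0; apply: contraNT e_notin => v0.
  have a0 : a != 0 by apply: contraNneq v0 => a0; rewrite va a0 scale0r.
  by rewrite -[e]scale1r -(mulVf a0) -scalerA -va memvZ.
move: wW ew; rewrite -UeW => /memv_addP[u uU [_ /vlineP[a ->] ->]].
rewrite dotvDr eU // add0r dotvZr => /eqP; rewrite mulf_eq0.
by rewrite (gt_eqF (dotvv_gt0 e0)) orbF => /eqP ->; rewrite scale0r addr0.
Qed.

End DotProduct.

(** * Spans, relative interiors and closedness of polytopes *)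

Section Polytopes.
Variables (R : realType) (d : nat).
Local Notation V := 'rV[R]_d.
Implicit Types (P F : set V) (U W : {vspace V}) (u v w x y e : V).

Lemma sub_aff_hull P x : P x -> aff_hull P x.
Proof.
by move=> Px; exists 1%N, (fun=> x), (fun=> 1); split=> //; rewrite big_ord1 ?scale1r.
Qed.

Lemma subr_mem_spanv P x y : P x -> P y -> x - y \in spanv P.
Proof.
move=> Px Py; apply/mem_spanv; first by exists x.
by exists x, y; split=> //; exact: sub_aff_hull.
Qed.

Lemma spanv_sub P W : P !=set0 ->
  (forall x y, P x -> P y -> x - y \in W) -> (spanv P <= W)%VS.
Proof.
move=> [p Pp] PW; have hull x : aff_hull P x -> x - p \in W.
  move=> [m [f [c [Pf c1 ->]]]]; rewrite -[p]scale1r -c1 scaler_suml -sumrB.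
  by apply: memv_suml => i _; rewrite -scalerBr memvZ // PW.
apply/subvP => v /mem_spanv [|x [y [/hull xW /hull yW ->]]]; first by exists p.
by rewrite -(subrKA p) -[p - y]opprB memvB.
Qed.

Lemma spanvS F P : F !=set0 -> F `<=` P -> (spanv F <= spanv P)%VS.
Proof. by move=> F0 FP; apply: spanv_sub => // x y /FP Px /FP Py; exact: subr_mem_spanv. Qed.

Lemma pdimE P : P !=set0 -> pdim P = (\dim (spanv P))%:Z.
Proof. by move=> /set0P/negPf; rewrite /pdim => ->. Qed.

Lemma pdim_set0 : pdim (set0 : set V) = -1.
Proof. by rewrite /pdim eqxx. Qed.

Lemma pdim_ge0 P : 0 <= pdim P -> P !=set0.
Proof. by rewrite /pdim; case: ifPn => // /set0P. Qed.

Lemma polytope_segment P x y t : polytope P -> P x -> P y -> 0 <= t <= 1 ->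
  P (x + t *: (y - x)).
Proof.
move=> [s ->] [a [a0 a1 ->]] [b [b0 b1 ->]] /andP[t0 t1].
exists (fun i => (1 - t) * a i + t * b i); split=> [i||].
- by rewrite addr_ge0 // mulr_ge0 // subr_ge0.
- rewrite big_split /= -!mulr_sumr a1 b1 !mulr1. by rewrite subrK.
- under [RHS]eq_bigr do rewrite scalerDl -!scalerA.
  by rewrite big_split /= -!scaler_sumr scalerBl scale1r scalerBr addrA addrAC.
Qed.

(** The relative interior, stated without a topology on the affine hull: from [q] one can move a
    little in every direction of the span. Only [t >= 0] is needed, since [- v] is a direction as
    well. *)
Definition relint P : set V := [set q | P q /\
  forall v, v \in spanv P -> exists2 a, 0 < a & forall t, 0 <= t <= a -> P (q + t *: v)].

(* The average of the generators of a polytope lies in its relative interior. *)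
Lemma polytope_relint P : polytope P -> P !=set0 -> relint P !=set0.
Proof.
move=> [s ->] P0; pose n : R := (size s)%:R.
have n0 : 0 < n.
  have [x [c [_ c1 _]]] := P0; rewrite ltr0n lt0n; apply/negP => /eqP s0.
  move: c1; rewrite big1 => [/esym/eqP|[i lis] _]; first by rewrite oner_eq0.
  by exfalso; move: lis; rewrite s0.
have sumn : \sum_(i < size s) n^-1 = 1.
  by rewrite sumr_const card_ord -mulr_natl divff // gt_eqF.
have hull x : aff_hull (conv_hull s) x ->
    exists2 a : 'I_(size s) -> R, \sum_i a i = 1 & x = \sum_i a i *: s`_i.
  move=> [m [p [c [Pp c1 ->]]]].
  have /choice[b bP] j : exists b : 'I_(size s) -> R,
      \sum_i b i = 1 /\ p j = \sum_i b i *: s`_i.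
    by have [b [_ b1 pb]] := Pp j; exists b.
  exists (fun i => \sum_j c j * b j i).
    rewrite exchange_big -[RHS]c1; apply: eq_bigr => j _.
    by rewrite -mulr_sumr (bP j).1 mulr1.
  under [RHS]eq_bigr do rewrite scaler_suml.
  rewrite exchange_big; apply: eq_bigr => j _; rewrite [in LHS](bP j).2 scaler_sumr.
  by apply: eq_bigr => i _; rewrite scalerA.
exists (\sum_(i < size s) n^-1 *: s`_i); split.
  by exists (fun=> n^-1); split=> // i; rewrite invr_ge0 ltW.
move=> v /(mem_spanv _ P0)[x [y [/hull[a a1 ->] /hull[b b1 ->] ->]]].
(* [M] bounds every weight difference, so the weights stay nonnegative for [t <= (n * M)^-1]; the
   summand 1 makes [M] positive even when [v = 0]. *)
pose M := 1 + \sum_i `|a i - b i|.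
have M0 : 0 < M by rewrite ltr_pwDl // sumr_ge0.
exists ((n * M)^-1) => [|t /andP[t0 tM]]; first by rewrite invr_gt0 mulr_gt0.
exists (fun i => n^-1 + t * (a i - b i)); split=> [i||].
- have : `|a i - b i| <= M.
    by rewrite /M (bigD1 i) //= addrCA lerDl addr_ge0 // sumr_ge0.
  move=> abM; rewrite -lerBlDl sub0r.
  have /ler_normlP[+ _] : `|t * (a i - b i)| <= n^-1.
    rewrite normrM ger0_norm // (le_trans (ler_wpM2l t0 abM)) //.
    rewrite (le_trans (ler_wpM2r (ltW M0) tM)) // invfM mulfVK ?gt_eqF //.
  by rewrite lerNl.
- by rewrite big_split /= sumn -mulr_sumr sumrB a1 b1 subrr mulr0 addr0.
- under [RHS]eq_bigr do rewrite scalerDl -scalerA scalerBl.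
  by rewrite big_split /= -!scaler_sumr sumrB.
Qed.

(** The hull is the image under the continuous map [f] of the standard simplex, a closed subset of
    the compact cube [K]; hence it is compact. *)
Lemma polytope_closed P : polytope P -> closed P.
Proof.
move=> [s ->]; apply: compact_closed; first exact: norm_hausdorff.
pose f (c : 'rV[R]_(size s)) : V := \sum_i c 0 i *: s`_i.
pose K := [set c : 'rV[R]_(size s) | forall i, `[0, 1]%classic (c 0 i)].
pose g (c : 'rV[R]_(size s)) : R := \sum_i c 0 i.
have cf : continuous f.
  apply: (continuous_big add_continuous) => i _ c.
  exact: (cvgZr_tmp (@coord_continuous R 1 (size s) 0 i c)).
have cg : continuous g.
  by apply: (continuous_big add_continuous) => i _; exact: coord_continuous.
have Kc : compact K.
  by apply: (@rV_compact R _ (fun=> `[0, 1]%classic)) => i; exact: segment_compact.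
have -> : conv_hull s = f @` (K `&` g @^-1` [set 1]).
  apply/seteqP; split=> x.
    move=> [c [c0 c1 ->]]; exists (\row_i c i); last first.
      by apply: eq_bigr => i _; rewrite mxE.
    split=> [i|]; last by rewrite /g /=; under eq_bigr do rewrite mxE.
    by rewrite /= mxE in_itv /= c0 -c1 (bigD1 i) //= lerDl sumr_ge0.
  move=> [c [cK cg1] <-]; exists (c 0); split=> // i.
  by have := cK i; rewrite /= in_itv /= => /andP[].
apply: continuous_compact; first exact: continuous_subspaceT.
apply: (subclosed_compact (B := K)).
- apply: closedI; last by apply: closed_comp => [c _|]; [exact: cg|exact: closed_eq].
  by apply: compact_closed Kc; exact: norm_hausdorff.
- exact: Kc.
- by move=> c [].
Qed.

Lemma closed_ray P q v : closed P ->
  (forall a, 0 < a -> exists2 t, 0 < t < a & P (q + t *: v)) -> P q.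
Proof.
move=> cP near0; apply: cP => B Bq.
have ct : {for 0, continuous (fun t : R => q + t *: v)}.
  by apply: continuousD; [exact: cvg_cst|exact: (cvgZr_tmp (@cvg_id _ (nbhs (0 : R))))].
move: ct; rewrite /prop_for /continuous_at /= scale0r addr0.
move=> /(_ B Bq)/nbhs_ballP[a a0 aB].
have [t /andP[t0 ta] Pt] := near0 a a0; exists (q + t *: v); split=> //.
by apply: aB; rewrite /ball /= sub0r normrN gtr0_norm.
Qed.

End Polytopes.

(** * Faces and facets described by normal vectors *)

Section Faces.
Variables (R : realType) (d : nat).
Local Notation V := 'rV[R]_d.
Implicit Types (P F Q : set V) (U W : {vspace V}) (u v w x y e q : V).

Lemma dotv_spanv P l c u : P !=set0 -> (forall x, P x -> dotv l x = c) ->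
  u \in spanv P -> dotv l u = 0.
Proof.
move=> P0 Pc; have hull x : aff_hull P x -> dotv l x = c.
  move=> [m [p [a [Pp a1 ->]]]]; rewrite -[RHS]mul1r -a1 mulr_suml.
  elim/big_rec2 : _ => [|i y z _ <-]; first by rewrite dotvC dotv0l.
  by rewrite dotvDr dotvZr Pc.
by move=> /(mem_spanv _ P0)[x [y [/hull xc /hull yc ->]]]; rewrite dotvBr xc yc subrr.
Qed.

Lemma face_subset F P : is_face F P -> F `<=` P.
Proof. by move=> [l [c [_ ->]]] x []. Qed.

Lemma is_face_set0 P : is_face set0 P.
Proof.
exists 0, 1; split=> [x _|]; first by rewrite dotv0l.
by apply/seteqP; split=> // x [_ /=]; rewrite dotv0l => /esym/eqP; rewrite oner_eq0.
Qed.

(** From [q] one can move inside [P] a little away from any point [x]; as [l] is maximal at [q], it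
    cannot be smaller at [x]. *)
Lemma face_relint F P q : is_face F P -> relint P q -> F q -> F = P.
Proof.
move=> [l [c [lc ->]]] [Pq ri] [_ /= lq]; apply/seteqP; split=> [x []//|x Px].
split=> //; apply/eqP; rewrite eq_le lc //= -lq -subr_le0 -dotvBr.
have [a a0 /(_ a)] := ri _ (subr_mem_spanv Pq Px).
rewrite lexx ltW // => /(_ isT)/lc; rewrite dotvDr dotvZr lq gerDl.
by rewrite pmulr_rle0.
Qed.

(** The functional cutting out [F] is constant on [F], so it vanishes on the common span and is
    constant on [P] too. *)
Lemma face_full_dim F P : is_face F P -> F !=set0 ->
  (\dim (spanv P) <= \dim (spanv F))%N -> F = P.
Proof.
move=> FP F0 dF; have FsubP := face_subset FP.
have FPv : spanv F = spanv P by apply/eqP; rewrite eqEdim dF spanvS.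
move: FP F0 FPv => [l [c [_ FE]]] F0 FPv; apply/seteqP; split=> // x Px.
have [y Fy] := F0.
have lF z : F z -> dotv l z = c by rewrite FE => -[].
have := dotv_spanv F0 lF; rewrite FPv => /(_ _ (subr_mem_spanv Px (FsubP _ Fy))).
by rewrite FE dotvBr (lF y) // => /subr0_eq ?; split.
Qed.

(** Otherwise [dotv e] would be constant on [P], making [e] orthogonal to the span of [P], which
    contains [e] itself. *)
Lemma inward_normal_witness F P e q : inward_normal F P e -> P q -> F q ->
  exists2 x, P x & 0 < dotv e (x - q).
Proof.
move=> [e0 eP _ ege0] Pq Fq; apply: contrapT => H.
have /dotv_spanv : forall x, P x -> dotv e x = dotv e q.
  move=> x Px; apply/eqP; rewrite -subr_eq0 -dotvBr eq_le ege0 // andbT leNgt.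
  by apply/negP => exq; apply: H; exists x.
by move=> /(_ e (ex_intro _ q Pq) eP)/eqP; rewrite gt_eqF // dotvv_gt0.
Qed.

Lemma inward_normalN F P e : F !=set0 -> F `<=` P ->
  inward_normal F P e -> ~ inward_normal F P (- e).
Proof.
move=> [q Fq] FP eF [_ _ _ /(_ _ _ _ Fq)]; have Pq := FP _ Fq.
have [x Px xq] := inward_normal_witness eF Pq Fq.
by move=> /(_ x Px); rewrite dotvNl oppr_ge0 leNgt xq.
Qed.

Section Codim1.
Variables (F P : set V) (e q : V).
Hypotheses (FP : F `<=` P) (Fq : F q) (e0 : e != 0) (eP : e \in spanv P).
Hypothesis eF : forall u, u \in spanv F -> dotv e u = 0.
Hypothesis dPF : \dim (spanv P) = (\dim (spanv F)).+1.

Let F0 : F !=set0. Proof. by exists q. Qed.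
Let Pq : P q. Proof. exact: FP. Qed.
Let sFP : (spanv F <= spanv P)%VS. Proof. exact: spanvS. Qed.

Lemma codim1_mem w : w \in spanv P -> dotv e w = 0 -> w \in spanv F.
Proof. exact: hyperplane_mem. Qed.

(** A facet is thus determined by a point of it and a normal, which later gives the uniqueness of
    the facet through a given cell. *)
Lemma facet_hyperplane : is_face F P -> F = P `&` [set x | dotv e (x - q) = 0].
Proof.
move=> [l [c [_ FE]]]; apply/seteqP; split=> x.
  by move=> Fx; split; [exact: FP|apply/eF/subr_mem_spanv].
move=> [Px /= exq]; have /(dotv_spanv F0) lF : forall y, F y -> dotv l y = c.
  by rewrite FE => y [].
have /lF : x - q \in spanv F by apply: codim1_mem => //; exact: subr_mem_spanv.
rewrite dotvBr => /subr0_eq lxq; rewrite FE; split=> //=.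
by rewrite lxq; move: Fq; rewrite FE => -[].
Qed.

(** The hyperplane through [q] orthogonal to [e] supports [P]. The functional is [- e] because faces
    maximise; [G] may be larger than [F], which need not be a face of [P]. *)
Lemma hyperplane_facet : (forall x, P x -> 0 <= dotv e (x - q)) ->
  exists2 G, is_face G P & F `<=` G /\ spanv G = spanv F.
Proof.
move=> ege0; pose G := P `&` [set x | dotv (- e) x = dotv (- e) q].
have FG : F `<=` G.
  move=> x Fx; split; first exact: FP.
  by rewrite /= !dotvNl; congr (- _); apply/subr0_eq; rewrite -dotvBr eF // subr_mem_spanv.
exists G.
  exists (- e), (dotv (- e) q); split=> // x /ege0.
  by rewrite !dotvNl dotvBr lerN2 subr_ge0.
split=> //; apply/eqP; rewrite eqEsubv; apply/andP; split; last exact: spanvS.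
have G0 : G !=set0 by exists q; exact: FG.
apply: spanv_sub => // x y [Px /= ex] [Py /= ey].
apply: codim1_mem; first exact: subr_mem_spanv.
by apply/eqP; rewrite -oppr_eq0 -dotvNl dotvBr ex ey subrr.
Qed.

(** The functional [l] defining [F] and [dotv e] both vanish on the span of [F], so they are
    proportional on the span of [P]. *)
Lemma facet_inward : is_face F P -> inward_normal F P e \/ inward_normal F P (- e).
Proof.
move=> /[dup] FPf [l [c [lc FE]]].
have lF u : u \in spanv F -> dotv l u = 0.
  by apply: (dotv_spanv F0 (c := c)) => x; rewrite FE => -[].
have lx x y : P x -> F y ->
    dotv l (x - y) * dotv e e = dotv e (x - y) * dotv l e.
  move=> Px Fy; set v := x - y.
  have vP : v \in spanv P by apply: subr_mem_spanv => //; exact: FP.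
  pose a := dotv e v / dotv e e.
  have ee0 : dotv e e != 0 by rewrite gt_eqF // dotvv_gt0.
  have : v - a *: e \in spanv F.
    apply: codim1_mem; first by rewrite memvB // memvZ.
    by rewrite dotvBr dotvZr divfK // subrr.
  move=> /lF; rewrite dotvBr dotvZr => /subr0_eq ->.
  by rewrite mulrAC divfK.
have lle x y : P x -> F y -> dotv e (x - y) * dotv l e <= 0.
  move=> Px Fy; rewrite -lx // pmulr_lle0 ?dotvv_gt0 // dotvBr subr_le0.
  by move: Fy; rewrite FE => -[_ /= ->]; exact: lc.
(* The sign of the proportionality factor selects [e] or [- e]; a zero factor would make [l]
   constant on [P], so [F = P], against the dimensions. *)
have [le0|le0|le0] := ltgtP (dotv l e) 0.
- by left; split=> // x y Px Fy; have := lle _ _ Px Fy; rewrite nmulr_lle0.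
- right; split=> [|||x y Px Fy]; rewrite ?oppr_eq0 ?memvN //.
    by move=> w wF; rewrite dotvNl eF // oppr0.
  by rewrite dotvNl oppr_ge0; have := lle _ _ Px Fy; rewrite pmulr_lle0.
- have PF : P `<=` F.
    move=> x Px; rewrite FE; split=> //=.
    have /eqP := lx x q Px Fq; rewrite le0 mulr0 mulf_eq0.
    rewrite (gt_eqF (dotvv_gt0 e0)) orbF dotvBr => /eqP/subr0_eq ->.
    by move: Fq; rewrite FE => -[].
  by have := dimvS (spanvS (ex_intro _ q Pq) PF); rewrite dPF ltnn.
Qed.

(** The difference [u] of [e'] and its projection on [e] lies in the span of [F], so it is
    orthogonal to [e] and [e'], hence to itself. A point of [P] off the hyperplane fixes the sign of
    [a]. *)
Lemma inward_normal_scale e' : inward_normal F P e -> inward_normal F P e' ->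
  exists2 a, 0 < a & e' = a *: e.
Proof.
move=> eI [e'0 e'P e'F e'ge0]; pose a := dotv e e' / dotv e e.
have ee0 : dotv e e != 0 by rewrite gt_eqF // dotvv_gt0.
pose u := e' - a *: e.
have uF : u \in spanv F.
  apply: codim1_mem; first by rewrite memvB // memvZ.
  by rewrite dotvBr dotvZr divfK // subrr.
have e'E : e' = a *: e.
  apply/subr0_eq/eqP; apply: contraTT (lexx (0 : R)) => /dotvv_gt0; rewrite -/u -ltNge.
  rewrite {2}/u dotvBr dotvZr (dotvC _ e') (dotvC _ e) e'F // eF //.
  by rewrite mulr0 subrr.
exists a => //; have [x Px xq] := inward_normal_witness eI Pq Fq.
have := e'ge0 _ _ Px Fq; rewrite e'E dotvC dotvZr dotvC pmulr_lge0 //.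
rewrite le_eqVlt => /predU1P[a0|//].
by move: e'0; rewrite e'E -a0 scale0r eqxx.
Qed.

End Codim1.

(** The vector [r - q] is not orthogonal to [e], so the span of [P] is strictly larger than that of
    [F]; nothing lies strictly between the latter and [W]. *)
Lemma spanv_codim1 F P W e r q : (spanv F <= spanv P)%VS -> (spanv P <= W)%VS ->
  \dim W = (\dim (spanv F)).+1 -> (forall u, u \in spanv F -> dotv e u = 0) ->
  P r -> P q -> 0 < dotv e (r - q) -> spanv P = W.
Proof.
move=> FP PW dW eF Pr Pq rq; apply/eqP; rewrite eqEdim PW dW ltnNge /=.
apply/negP => PF; have /eqP FPe : spanv F == spanv P by rewrite eqEdim FP.
by move: rq; rewrite eF ?ltxx // FPe; exact: subr_mem_spanv.
Qed.

End Faces.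

(** * Orientations as signs of bases, and the two incidence signs *)

Section Orientations.
Variables (R : realType) (d : nat).
Local Notation V := 'rV[R]_d.
Implicit Types (P F Q : set V) (U W : {vspace V}) (b w : seq V) (o : set (seq V)).

Definition osgn o b : int := if `[< o b >] then 1 else -1.

Lemma osgn_sqr o b : osgn o b * osgn o b = 1.
Proof. by rewrite /osgn; case: ifP. Qed.

(** The size of [change_basis] depends on the list; a fixed index [n] allows such matrices for
    different bases to be multiplied. *)
Lemma change_basis_det n b (sz : size b == n) b' :
  \det (change_basis b b') = \det (\matrix_(i < n, j < n) coord (Tuple sz) j b'`_i).
Proof.
have e := eqP sz; subst n; congr (\det _); apply/matrixP => i j; rewrite !mxE.
by congr (coord _ j _); exact: val_inj.
Qed.

Lemma basis_size U b : basis_of U b -> size b = \dim U.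
Proof. by move=> bU; exact/esym/(size_basis (X := in_tuple b)). Qed.

Lemma mem_basis_nth U b i : basis_of U b -> (i < size b)%N -> b`_i \in U.
Proof. by move=> bU ib; apply: (basis_mem bU); exact: mem_nth. Qed.

Lemma change_basis_trans U b b1 b2 :
  basis_of U b -> basis_of U b1 -> basis_of U b2 ->
  \det (change_basis b b2) = \det (change_basis b b1) * \det (change_basis b1 b2).
Proof.
move=> bU b1U b2U.
have sb : size b == \dim U by rewrite (basis_size bU).
have sb1 : size b1 == \dim U by rewrite (basis_size b1U).
rewrite !(change_basis_det sb) (change_basis_det sb1) mulrC -det_mulmx.
congr (\det _); apply/matrixP => i j; rewrite !mxE.
have b2i : b2`_i \in <<Tuple sb1>>%VS.
  by rewrite (span_basis b1U) (mem_basis_nth b2U) // (basis_size b2U).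
rewrite {1}(coord_span b2i) linear_sum; apply: eq_bigr => k _.
by rewrite linearZ !mxE.
Qed.

Lemma change_basis_neq0 U b b' : basis_of U b -> basis_of U b' ->
  \det (change_basis b b') != 0.
Proof.
move=> bU b'U; have : \det (change_basis b b) != 0.
  rewrite (_ : change_basis b b = 1%:M) ?det1 ?oner_eq0 //.
  apply/matrixP => i j; rewrite !mxE.
  by rewrite (coord_free (X := in_tuple b) i j (basis_free bU)) eq_sym.
by rewrite (change_basis_trans bU b'U bU) mulf_eq0 => /norP[].
Qed.

Lemma osgn_change U o b b' : is_orientation U o -> basis_of U b -> basis_of U b' ->
  osgn o b' = osgn o b * sgz (\det (change_basis b b')).
Proof.
move=> [oU [b0 ob0] oE] bU b'U; have b0U := oU _ ob0.
have osE c : basis_of U c -> osgn o c = sgz (\det (change_basis b0 c)).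
  move=> cU; have := change_basis_neq0 b0U cU; rewrite /osgn.
  have -> : `[< o c >] = (0 < \det (change_basis b0 c)).
    by apply/asboolP/idP => /(oE _ _ ob0 cU).
  by case: sgzP.
by rewrite !osE // (change_basis_trans b0U bU b'U) sgzM.
Qed.

(** By [osgn_change] an orientation is determined by its sign on the single basis [b]. *)
Lemma osgn_eq U o o' b : is_orientation U o -> is_orientation U o' ->
  basis_of U b -> (if `[< o = o' >] then 1 else -1) = osgn o b * osgn o' b.
Proof.
move=> oO o'O bU; case: asboolP => [->|neq]; first by rewrite osgn_sqr.
suff : osgn o b != osgn o' b by rewrite /osgn; do 2!case: ifP.
apply: contra_notN neq => /eqP oo'; apply/seteqP.
have same c : basis_of U c -> o c <-> o' c.
  move=> cU; have : osgn o c = osgn o' c.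
    by rewrite (osgn_change oO bU cU) (osgn_change o'O bU cU) oo'.
  by rewrite /osgn; do 2!case: asboolP.
have [[oU _ _] [pU _ _]] := (oO, o'O).
by split=> c oc; apply/(same c) => //; [exact: oU|exact: pU].
Qed.

Lemma orientation_dim0 U o : is_orientation U o -> \dim U = 0%N -> o [::].
Proof.
by case=> oU [b ob] _ dU; have /basis_size := oU _ ob; rewrite dU => /size0nil <-.
Qed.

Lemma basis_cons U W e w : basis_of U w -> (U <= W)%VS -> e \in W -> e \notin U ->
  \dim W = (\dim U).+1 -> basis_of W (e :: w).
Proof.
move=> wU UW eW eU dW.
rewrite basisEfree free_cons (span_basis wU) eU (basis_free wU) /=.
by rewrite span_cons subv_add -memvE eW (span_basis wU) UW dW (basis_size wU) /=.
Qed.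

(** The first row of the matrix is [a] followed by zeros, and the complementary minor is
    [change_basis w w']. *)
Lemma det_change_basis_cons U W e a w w' :
  basis_of W (e :: w) -> basis_of U w -> basis_of U w' ->
  \det (change_basis (e :: w) (a *: e :: w')) = a * \det (change_basis w w').
Proof.
move=> ewW wU w'U; have fr := basis_free ewW.
rewrite (expand_det_row _ ord0) big_ord_recl big1 => [|j _]; last first.
  rewrite mxE /= linearZ /= -[e]/((in_tuple (e :: w))`_(ord0 : 'I_(size w).+1)).
  by rewrite (coord_free (X := in_tuple (e :: w)) _ _ fr) mulr0 mul0r.
rewrite addr0 mxE /= linearZ /= -[X in coord _ _ X]/((in_tuple (e :: w))`_(ord0 : 'I_(size w).+1)).
rewrite (coord_free (X := in_tuple (e :: w)) _ _ fr) eqxx /= mulr1; congr (_ * _).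
rewrite /cofactor expr0 mul1r; congr (\det _); apply/matrixP => i j; rewrite !mxE /=.
have w'i : w'`_i \in <<in_tuple w>>%VS.
  by rewrite (span_basis wU) (mem_basis_nth w'U) // (basis_size w'U) -(basis_size wU).
rewrite {1}(coord_span w'i) linear_sum (bigD1 j) //= big1 => [|k kj].
  rewrite linearZ /= -[w`_j]/((in_tuple (e :: w))`_(lift ord0 j)).
  by rewrite (coord_free (X := in_tuple (e :: w)) _ _ fr) eqxx mulr1 addr0.
rewrite linearZ /= -[w`_k]/((in_tuple (e :: w))`_(lift ord0 k)).
by rewrite (coord_free (X := in_tuple (e :: w)) _ _ fr) (inj_eq lift_inj) (negPf kj) mulr0.
Qed.

Lemma osgn_cons_scale U W o e a w : is_orientation W o ->
  basis_of W (e :: w) -> basis_of U w -> a != 0 -> basis_of W (a *: e :: w) ->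
  osgn o (a *: e :: w) = sgz a * osgn o (e :: w).
Proof.
move=> oW ewW wU a0 aewW; rewrite (osgn_change oW ewW aewW) mulrC.
rewrite (det_change_basis_cons a ewW wU wU) sgzM.
(* The determinant of [change_basis w w] is nonzero and equal to its square, hence 1. *)
have := change_basis_trans wU wU wU; have := change_basis_neq0 wU wU.
by move=> d0 /(congr1 (fun x => x / \det (change_basis w w)));
  rewrite mulfK // divff // => <-; rewrite sgz1 mulr1.
Qed.

(** The product form lets the orientation of an intermediate cell cancel against its second
    occurrence in [sgn_facetE]. In dimension 0 both factors are 1, the empty basis being
    positive. *)
Lemma sgn_subE P o o' b : P !=set0 -> is_orientation (spanv P) o ->
  is_orientation (spanv P) o' -> basis_of (spanv P) b ->
  sgn_sub P o o' = osgn o b * osgn o' b.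
Proof.
move=> P0 oO o'O bP; rewrite -(osgn_eq oO o'O bP) /sgn_sub.
case: ifP => //; rewrite pdimE // => dP.
have dP0 : \dim (spanv P) = 0%N by move: dP; case: (\dim _).
rewrite (osgn_eq oO o'O bP).
have -> : b = [::] by apply: size0nil; rewrite (basis_size bP).
by rewrite /osgn !asboolT //; apply: (orientation_dim0 _ dP0).
Qed.

(* The factor [osgn oF w * osgn oP (e :: w)] does not depend on the basis [w]. *)
Lemma sgn_facetE F P oF oP e w : F !=set0 -> F `<=` P ->
  \dim (spanv P) = (\dim (spanv F)).+1 ->
  is_orientation (spanv F) oF -> is_orientation (spanv P) oP ->
  inward_normal F P e -> basis_of (spanv F) w ->
  sgn_facet F oF P oP = osgn oF w * osgn oP (e :: w).
Proof.
move=> F0 FP dP oFO oPO eI wF; have [q Fq] := F0; have P0 : P !=set0 by exists q; exact: FP.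
have [e0 eP eF _] := eI.
have eNF := normal_notin e0 eF.
have sFP := spanvS F0 FP.
have basis_cs a w' : a != 0 -> basis_of (spanv F) w' -> basis_of (spanv P) (a *: e :: w').
  move=> a0 w'F; apply: (basis_cons w'F) => //; first by rewrite memvZ.
  by apply: contra eNF => /(memvZ a^-1); rewrite scalerA mulVf // scale1r.
have basis_e w' : basis_of (spanv F) w' -> basis_of (spanv P) (e :: w').
  by move=> /(basis_cs 1); rewrite scale1r; apply; rewrite oner_eq0.
(* Passing from [w] to [w'] multiplies both factors by the sign of the same determinant, and a
   positive [a] has sign 1. *)
have indep a w' : 0 < a -> basis_of (spanv F) w' ->
    osgn oF w' * osgn oP (a *: e :: w') = osgn oF w * osgn oP (e :: w).
  move=> a0 w'F; have an0 : a != 0 by rewrite gt_eqF.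
  have aw'P := basis_cs _ _ an0 w'F.
  rewrite (osgn_change oPO (basis_e _ wF) aw'P) (osgn_change oFO wF w'F).
  rewrite (det_change_basis_cons a (basis_e _ wF) wF w'F) sgzM (gtr0_sgz a0) mul1r.
  rewrite mulrACA -[RHS]mulr1; congr (_ * _).
  by have := change_basis_neq0 wF w'F; case: sgzP.
have main : `[< exists e' w', [/\ inward_normal F P e', oF w' & oP (e' :: w')] >] =
    (osgn oF w * osgn oP (e :: w) == 1).
  apply/asboolP/eqP.
    move=> [e' [w' [e'I ow' oew']]].
    have [a a0 e'E] := inward_normal_scale FP Fq e0 eP eF dP eI e'I.
    have w'F : basis_of (spanv F) w' by case: oFO => + _ _; apply.
    by rewrite -(indep a w' a0 w'F) -e'E /osgn !asboolT.
  move=> pr1; have [oFb [w' ow'] _] := oFO; have w'F := oFb _ ow'.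
  exists e, w'; split=> //.
  have := indep 1 w' ltr01 w'F; rewrite scale1r pr1 {1}/osgn asboolT // mul1r.
  by rewrite /osgn; case: asboolP.
have fin : osgn oF w * osgn oP (e :: w) =
    if osgn oF w * osgn oP (e :: w) == 1 then 1 else -1.
  by rewrite /osgn; do 2!case: ifP.
rewrite /sgn_facet pdimE // dP /= fin -main.
(* For a segment [P] the definition tests only [[:: e']]; this is the general test, as the only
   basis of the span of [F] is empty. *)
case: eqP => [[dF0]|//]; congr (if _ then _ else _); apply/asbool_equiv_eq; split.
  by move=> [e' e'I oe']; exists e', [::]; split=> //; exact: orientation_dim0 oFO dF0.
move=> [e' [w' [e'I ow' oew']]]; exists e' => //.
suff -> : [::] = w' by [].
by case: oFO => /(_ _ ow')/basis_size + _ _; rewrite dF0 => /size0nil.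
Qed.

End Orientations.

(** * Existence and uniqueness of the cell on a given side *)

Section Cells.
Variables (R : realType) (d : nat) (X : cell_complex R d).
Local Notation V := 'rV[R]_d.
Implicit Types (P Q F : set V) (e q p : V).

(* Finitely many cells cover the segment from [q] to [p], so one of them meets it
   arbitrarily close to [q]; being closed, that cell contains [q]. *)
Lemma cell_near_point (A : set (set V)) q p : A `<=` [set` faces X] ->
  (forall t : R, 0 < t <= 1 -> (\bigcup_(P in A) P) (q + t *: (p - q))) ->
  exists P, [/\ A P, P q & exists2 t, 0 < t & P (q + t *: (p - q))].
Proof.
move=> AX cov; suff [P AP near0] : exists2 P, A P &
    forall a : R, 0 < a -> exists2 t, 0 < t < a & P (q + t *: (p - q)).
  exists P; split=> //; last by have [t /andP[t0 _] Pt] := near0 1 ltr01; exists t.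
  by apply: closed_ray near0; exact: polytope_closed (face_polytope (AX _ AP)).
apply: contrapT => none.
have /choice[f fP] (s : faces X) : exists a : R, 0 < a /\
    (A (val s) -> forall t, 0 < t < a -> ~ val s (q + t *: (p - q))).
  have [As|nAs] := pselect (A (val s)); last by exists 1.
  apply: contrapT => /forallNP H; apply: none; exists (val s) => // a a0.
  apply: contrapT => Ht; apply: (H a); split=> // _ t t0 st.
  by apply: Ht; exists t.
(* With [a] below every [f s], no cell of [A] contains the point of parameter [a / 2], contradicting
   the covering. *)
pose a := \big[Num.min/1]_(s : faces X) f s.
have a0 : 0 < a by apply: lt_bigmin => // s _; exact: (fP s).1.
have a1 : a <= 1 by exact: bigmin_le_id.
have a2 : 0 < a / 2 by rewrite divr_gt0.
have [|P AP Pa] := cov (a / 2); first by rewrite a2; lra.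
have PX := AX _ AP; pose s : faces X := [` PX]%fset.
apply: ((fP s).2 AP (a / 2)) => //; rewrite a2 /=.
have : a <= f s by exact: bigmin_le.
lra.
Qed.

(** Some cell [P] contains [q] and a point further along the segment to [p]. Its intersection with
    [F] is a face of [F] through the relative interior point [q], hence all of [F]; the second point
    makes [P] full-dimensional in [Q] and fixes the inward side. *)
Lemma exists_side_cell (A : set (set V)) Q F q e p : polytope Q ->
  A `<=` [set` faces X] -> Q = \bigcup_(P in A) P ->
  F \in faces X -> F `<=` Q -> relint F q ->
  (forall u, u \in spanv F -> dotv e u = 0) -> e != 0 -> e \in spanv Q ->
  \dim (spanv Q) = (\dim (spanv F)).+1 -> Q p -> 0 < dotv e (p - q) ->
  exists P, [/\ P \in faces X, P `<=` Q, spanv P = spanv Q, is_face F P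
    & inward_normal F P e].
Proof.
move=> polQ AX QA FX FQ ri eF e0 eQ dQ Qp epq.
have [Fq _] := ri; have Qq := FQ _ Fq; have F0 : F !=set0 by exists q.
have [t /andP[t0 t1]|P [AP Pq [t t0 Pt]]] := @cell_near_point A q p AX.
  by rewrite -QA; apply: polytope_segment => //; rewrite ltW.
have PX := AX _ AP; have PQ : P `<=` Q by rewrite QA; exact: bigcup_sup.
have [PFP PFF] := face_inter PX FX.
have PFe : P `&` F = F by exact: face_relint PFF ri _.
have FP : F `<=` P by rewrite -PFe; exact: subIsetl.
rewrite PFe in PFP.
have er : 0 < dotv e (q + t *: (p - q) - q) by rewrite addrC addKr dotvZr mulr_gt0.
have P0 : P !=set0 by exists q.
have PQs : spanv P = spanv Q.
  exact: (spanv_codim1 (spanvS F0 FP) (spanvS P0 PQ) dQ eF Pt Pq er).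
exists P; split=> //.
have dP : \dim (spanv P) = (\dim (spanv F)).+1 by rewrite PQs.
have eP : e \in spanv P by rewrite PQs.
case: (facet_inward FP Fq e0 eP eF dP PFP) => // -[_ _ _ /(_ _ _ Pt Fq)].
by rewrite dotvNl oppr_ge0 leNgt er.
Qed.

(** Near [q] the two cells share a point [r] strictly on the side of [e], so their intersection
    spans [W]; a common face of full dimension equals both cells. *)
Lemma unique_side_cell W P1 P2 F q e : P1 \in faces X -> P2 \in faces X ->
  F `<=` P1 -> F `<=` P2 -> relint F q ->
  spanv P1 = W -> spanv P2 = W -> \dim W = (\dim (spanv F)).+1 ->
  inward_normal F P1 e -> inward_normal F P2 e -> P1 = P2.
Proof.
move=> P1X P2X FP1 FP2 [Fq ri] P1W P2W dW e1 e2.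
have P1q := FP1 _ Fq; have P2q := FP2 _ Fq; have F0 : F !=set0 by exists q.
have [e0 + eF _] := e1; rewrite P1W => eW.
have [x1 P1x x1q] := inward_normal_witness e1 P1q Fq.
have [x2 P2x x2q] := inward_normal_witness e2 P2q Fq.
(* This factor brings both points to the same height over the hyperplane, so [u] is a direction of
   [F]. *)
pose a := dotv e (x2 - q) / dotv e (x1 - q).
have a0 : 0 < a by rewrite divr_gt0.
pose u := (x2 - q) - a *: (x1 - q).
have uF : u \in spanv F.
  have x2W : x2 - q \in W by rewrite -P2W; exact: subr_mem_spanv.
  have x1W : x1 - q \in W by rewrite -P1W; exact: subr_mem_spanv.
  apply: (hyperplane_mem (W := W) (e := e)) => //.
  - by rewrite -P1W; exact: spanvS.
  - by rewrite memvB // memvZ.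
  - by rewrite dotvBr dotvZr divfK ?subrr // gt_eqF.
have [c c0 cF] := ri _ uF.
(* [q + t *: (x2 - q)] is the midpoint of [q + 2 * t *: u] and
   [q + 2 * t * a *: (x1 - q)], hence lies in both cells for small [t]. *)
pose t := Num.min (c / 2) (Num.min (a^-1 / 2) 1).
have t0 : 0 < t by rewrite !lt_min !divr_gt0 // ?invr_gt0 // ltr01.
have tc : t * 2 <= c by rewrite -ler_pdivlMr // ge_min lexx.
have ta : t * 2 * a <= 1.
  by rewrite -ler_pdivlMr // div1r -ler_pdivlMr // !ge_min lexx orbT.
have t1 : t <= 1 by rewrite !ge_min lexx !orbT.
pose r := q + t *: (x2 - q).
have P2r : P2 r.
  by apply: polytope_segment => //; [exact: face_polytope P2X|rewrite ltW].
have P1r : P1 r.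
  have pol1 := face_polytope P1X.
  have P1y : P1 (q + (t * 2) *: u) by apply/FP1/cF; rewrite tc mulr_ge0 // ltW.
  have P1z : P1 (q + (t * 2 * a) *: (x1 - q)).
    by apply: polytope_segment => //; rewrite ta andbT; apply/ltW/mulr_gt0/a0/mulr_gt0.
  have -> : r = (q + (t * 2) *: u) +
      2^-1 *: ((q + (t * 2 * a) *: (x1 - q)) - (q + (t * 2) *: u)).
    rewrite /r; have -> : x2 - q = u + a *: (x1 - q) by rewrite subrK.
    by apply/rowP => i; rewrite !mxE; field.
  apply: polytope_segment => //; apply/andP; split; lra.
have Gr : (P1 `&` P2) r by [].
have Gq : (P1 `&` P2) q by [].
have G0 : P1 `&` P2 !=set0 by exists q.
have FG : F `<=` P1 `&` P2 by rewrite subsetI.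
have er : 0 < dotv e (r - q) by rewrite /r addrC addKr dotvZr mulr_gt0.
have GW : spanv (P1 `&` P2) = W.
  apply: (spanv_codim1 _ _ dW eF Gr Gq er); first exact: spanvS.
  by rewrite -P1W; apply: spanvS => //; exact: subIsetl.
have [f1 f2] := face_inter P1X P2X.
have <- : P1 `&` P2 = P1 by apply: face_full_dim => //; rewrite GW P1W.
by apply: face_full_dim => //; rewrite GW P2W.
Qed.

End Cells.

(** * Labels and monomial quotients *)

Lemma mlcmA n : associative (@mpoly.mlcm n).
Proof. by move=> m1 m2 m3; apply/mpoly.mnmP => i; rewrite !mpoly.mnmE maxnA. Qed.

HB.instance Definition _ n := Monoid.isComLaw.Build (mpoly.multinom n) (@mpoly.mnm0 n)
  (@mpoly.mlcm n) (@mlcmA n) (@mpoly.mlcmC n) (@mpoly.mlc0m n).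

Section Labels.
Variables (R : realType) (d n : nat).
Implicit Types (X Y : labeled_complex R d n) (m : mpoly.multinom n).

Lemma mquotE m m' (z : 'rV[R[i]]_n) : mquot m m' z = \prod_(i < n) z 0 i ^+ (m i - m' i).
Proof. by rewrite /mquot mpoly.mevalX; apply: eq_bigr => i _; rewrite mpoly.mnmBE. Qed.

(** Exponents are subtracted with truncation at 0; divisibility makes the differences add up. *)
Lemma mquotM m m1 m2 (z : 'rV[R[i]]_n) : mpoly.lem m1 m -> mpoly.lem m2 m1 ->
  mquot m m1 z * mquot m1 m2 z = mquot m m2 z.
Proof.
move=> /mpoly.mnm_lepP m1m /mpoly.mnm_lepP m21; rewrite !mquotE -big_split.
apply: eq_bigr => i _ /=; rewrite -exprD; congr (_ ^+ _).
by have := m1m i; have := m21 i; lia.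
Qed.

Lemma holomorphic_mquot m m' : holomorphic (@mquot R n m m').
Proof.
move=> z; rewrite (_ : mquot m m' = fun z => \prod_(i < n) z 0 i ^+ (m i - m' i)); last first.
  by apply/funext => x; rewrite mquotE.
elim: (index_enum _) => [|i r IH].
  by rewrite (_ : (fun z => _) = cst 1) // funeqE => x; rewrite big_nil.
rewrite (_ : (fun z => _) = (fun z : 'rV[R[i]]_n => z 0 i) ^+ (m i - m' i) *
    (fun z => \prod_(j <- r) z 0 j ^+ (m j - m' j))); last first.
  by rewrite funeqE => x; rewrite big_cons /GRing.mul /= exprfctE.
apply: differentiableM => //; case: (m i - m' i)%N => [|p].
  by rewrite expr0; exact: differentiable_cst.
by apply: differentiableX; exact: differentiable_coord.
Qed.

Lemma face_cell (X : cell_complex R d) P F : P \in faces X -> F \in faces X ->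
  F `<=` P -> is_face F P.
Proof.
by move=> PX FX FP; have [+ _] := face_inter PX FX; rewrite (setIidr FP).
Qed.

(** A vertex of [F] is a cell contained in [P], hence a vertex of [P] by [face_cell], so its label
    enters the least common multiple for [P]. *)
Lemma flabel_mono X P F : P \in faces X -> F \in faces X -> F `<=` P ->
  mpoly.lem (flabel X F) (flabel X P).
Proof.
move=> PX FX FP; rewrite /flabel; elim/big_ind: _ => [|m m1 hm hm1|v /asboolP vF].
- by apply/mpoly.mnm_lepP => i; rewrite mpoly.mnm0E.
- by rewrite mpoly.lem_mlcm hm hm1.
- have vP : is_face (pset v) P.
    by apply: (@face_cell X) => //; [exact: (valP (val v))|apply: subset_trans (face_subset vF) _].
  rewrite (bigD1 v) /=; last by apply/asboolP.
  exact: mpoly.lem_mlcml.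
Qed.

End Labels.

(** * Faces indexed by dimension *)

Lemma pdim_lt0 (R : realType) d (P : set 'rV[R]_d) : pdim P < 0 -> P = set0.
Proof. by rewrite /pdim; case: eqP. Qed.

Section Kfaces.
Variables (R : realType) (d : nat) (X : cell_complex R d) (k : int).

Lemma pset_mem (s : kfaces X k) : pset s \in faces X.
Proof. exact: (valP (val s)). Qed.

Lemma pset_dim (s : kfaces X k) : pdim (pset s) = k.
Proof. exact/eqP/(valP s). Qed.

Lemma pset_inj : injective (@pset R d X k).
Proof. by move=> s t st; do 2!apply: val_inj. Qed.

Lemma kfaces_surj P : P \in faces X -> pdim P = k -> exists s : kfaces X k, pset s = P.
Proof. by move=> PX /eqP Pk; exists (exist _ [` PX]%fset Pk). Qed.

End Kfaces.

(** * The identity between sums of signs *)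

Section SignSum.
Variables (R : realType) (d n : nat) (X Y : oriented_labeled_complex R d n).
Hypothesis refXY : refines X Y.
Local Notation ori s := (orient (val s)).

Section PositiveDimension.
Variables (k : int) (k1 : 1 <= k) (s : kfaces Y k) (t' : kfaces X (k - 1)).
Hypothesis st' : pset t' `<=` pset s.

Let F := pset t'.
Let Q := pset s.
Let w := vbasis (spanv F) : seq 'rV[R]_d.

Let F0 : F !=set0. Proof. by apply: pdim_ge0; rewrite pset_dim; lia. Qed.
Let Q0 : Q !=set0. Proof. by apply: pdim_ge0; rewrite pset_dim; lia. Qed.

Let dQF : \dim (spanv Q) = (\dim (spanv F)).+1.
Proof.
have := pset_dim s; have := pset_dim t'; rewrite !pdimE //.
move: (\dim _) (\dim _) => a b; lia.
Qed.

Let spanv_side (s' : kfaces X k) : pset s' `<=` Q -> spanv (pset s') = spanv Q.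
Proof.
move=> sQ; have s'0 : pset s' !=set0 by apply: pdim_ge0; rewrite pset_dim; lia.
apply/eqP; rewrite eqEdim spanvS //=.
have : pdim Q = pdim (pset s') by rewrite !pset_dim.
by rewrite !pdimE // => -[->].
Qed.

Let spanv_facet (t : kfaces Y (k - 1)) : F `<=` pset t -> spanv (pset t) = spanv F.
Proof.
move=> Ft; have t0 : pset t !=set0 by apply: pdim_ge0; rewrite pset_dim; lia.
apply/esym/eqP; rewrite eqEdim spanvS //=.
have : pdim F = pdim (pset t) by rewrite !pset_dim.
by rewrite !pdimE // => -[->].
Qed.

Section Side.
Variables (q e : 'rV[R]_d).
Hypotheses (ri : relint F q) (e0 : e != 0) (eQ : e \in spanv Q).
Hypothesis eF : forall u, u \in spanv F -> dotv e u = 0.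

Definition on_side e := exists2 p, Q p & 0 < dotv e (p - q).

Let Fq : F q. Proof. by case: ri. Qed.

(** At most one cell of [X] in [Q] has [F] as a facet and [e] as inward normal, and it exists
    exactly when [Q] has points on that side. *)
Lemma cell_side_sum :
  \sum_(s' : kfaces X k | [&& `[< pset s' `<=` Q >], `[< is_facet F (pset s') >]
      & `[< inward_normal F (pset s') e >]])
    sgn_sub Q (ori s') (ori s) * sgn_facet F (ori t') (pset s') (ori s') =
  if `[< on_side e >] then osgn (ori t') w * osgn (ori s) (e :: w) else 0.
Proof.
have [_ refU _] := refXY; have [A AX QA] := refU _ (pset_mem s).
case: asboolP => [[p Qp pq]|noside]; last first.
  apply: big_pred0 => s'; apply/negP => /and3P[/asboolP sQ /asboolP[fF _] /asboolP ins].
  have [x sx xq] := inward_normal_witness ins (face_subset fF Fq) Fq.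
  by apply: noside; exists x => //; exact: sQ.
have [P [PX PQ PQs FP inP]] := exists_side_cell (face_polytope (pset_mem s)) AX QA
  (pset_mem t') st' ri eF e0 eQ dQF Qp pq.
have FsubP := face_subset FP.
have P0 : P !=set0 by exists q; exact: FsubP.
have [s0 s0P] : exists s0 : kfaces X k, pset s0 = P.
  by apply: kfaces_surj => //; rewrite pdimE // PQs -pdimE // pset_dim.
rewrite (big_pred1 s0) => [|s' /=]; last first.
  apply/and3P/eqP => [[/asboolP sQ /asboolP[fF _] /asboolP ins]|->].
    apply: pset_inj; rewrite s0P.
    exact: (unique_side_cell (pset_mem s') PX (face_subset fF) FsubP ri
      (spanv_side sQ) PQs dQF ins inP).
  rewrite s0P; split; apply/asboolP => //; split=> //.
  by rewrite pset_dim -s0P pset_dim.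
have oP : is_orientation (spanv Q) (ori s0) by rewrite -PQs -s0P; exact: orientP.
have wF : basis_of (spanv F) w by exact: vbasisP.
have eNF := normal_notin e0 eF.
have ewQ := basis_cons wF (spanvS F0 st') eQ eNF dQF.
rewrite (sgn_subE Q0 oP (orientP _) ewQ) s0P.
rewrite (sgn_facetE F0 FsubP _ (orientP _) _ inP wF) ?PQs //.
(* The sign of the orientation of [s0] on [e :: w] occurs twice and squares to 1. *)
by rewrite [LHS]mulrC -mulrA [X in _ * X]mulrA osgn_sqr mul1r.
Qed.

(** As [Q] lies on one side, the hyperplane through [q] supports it and cuts out the only facet [G]
    containing [F]; the orientation of [G] cancels. *)
Lemma facet_side_sum : on_side e -> ~ on_side (- e) ->
  \sum_(t : kfaces Y (k - 1) | `[< is_facet (pset t) Q >] && `[< F `<=` pset t >])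
    sgn_facet (pset t) (ori t) Q (ori s) * sgn_sub (pset t) (ori t') (ori t) =
  osgn (ori t') w * osgn (ori s) (e :: w).
Proof.
move=> side nside.
have ege0 x : Q x -> 0 <= dotv e (x - q).
  by move=> Qx; rewrite leNgt; apply/negP => exq; apply: nside; exists x;
    rewrite // dotvNl oppr_gt0.
have [G GQ [FG GF]] := hyperplane_facet st' Fq e0 eQ eF dQF ege0.
have G0 : G !=set0 by exists q; exact: FG.
have [t0 t0G] : exists t0 : kfaces Y (k - 1), pset t0 = G.
  apply: kfaces_surj; first exact: face_closed (pset_mem s) GQ.
  by rewrite pdimE // GF -pdimE // pset_dim.
have hyp (t : kfaces Y (k - 1)) : is_face (pset t) Q -> F `<=` pset t ->
    pset t = Q `&` [set x | dotv e (x - q) = 0].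
  move=> tQ Ft; apply: facet_hyperplane => //; rewrite ?spanv_facet //.
  - exact: face_subset.
  - exact: Ft.
rewrite (big_pred1 t0) => [|t /=]; last first.
  apply/andP/eqP => [[/asboolP[tQ _] /asboolP Ft]|->].
    by apply: pset_inj; rewrite [LHS]hyp // [RHS]hyp ?t0G.
  by rewrite t0G; split; apply/asboolP => //; split=> //; rewrite -t0G !pset_dim.
have wG : basis_of (spanv G) w by rewrite GF; exact: vbasisP.
have inG : inward_normal G Q e.
  have := facet_inward (face_subset GQ) (FG _ Fq) e0 eQ.
  rewrite GF => /(_ eF dQF GQ)[//|inN].
  have [x Qx xq] := inward_normal_witness inN (st' Fq) (FG _ Fq).
  by exfalso; apply: nside; exists x.
have oG : is_orientation (spanv G) (ori t0) by rewrite -t0G; exact: orientP.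
have oF : is_orientation (spanv G) (ori t') by rewrite GF; exact: orientP.
rewrite t0G (sgn_facetE G0 (face_subset GQ) _ oG (orientP _) inG wG) ?GF //.
rewrite (sgn_subE G0 oF oG wG).
by rewrite [LHS]mulrC -mulrA [X in _ * X]mulrA osgn_sqr mul1r.
Qed.

End Side.

Lemma sign_sum_sub :
  \sum_(t : kfaces Y (k - 1) | `[< is_facet (pset t) Q >] && `[< F `<=` pset t >])
    sgn_facet (pset t) (ori t) Q (ori s) * sgn_sub (pset t) (ori t') (ori t) =
  \sum_(s' : kfaces X k | `[< pset s' `<=` Q >] && `[< is_facet F (pset s') >])
    sgn_sub Q (ori s') (ori s) * sgn_facet F (ori t') (pset s') (ori s').
Proof.
have [q ri] := polytope_relint (face_polytope (pset_mem t')) F0.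
have [Fq _] := ri; have Qq := st' Fq.
have [e [e0 eQ eF]] : exists e, [/\ e != 0, e \in spanv Q
    & forall u, u \in spanv F -> dotv e u = 0] by apply: exists_normal; rewrite dQF.
have Ne0 : - e != 0 by rewrite oppr_eq0.
have NeQ : - e \in spanv Q by rewrite memvN.
have NeF u : u \in spanv F -> dotv (- e) u = 0 by move=> /eF; rewrite dotvNl => ->; rewrite oppr0.
have wF : basis_of (spanv F) w by exact: vbasisP.
have eNF := normal_notin e0 eF.
have ewQ := basis_cons wF (spanvS F0 st') eQ eNF dQF.
have gN : osgn (ori s) (- e :: w) = - osgn (ori s) (e :: w).
  have NewQ : basis_of (spanv Q) (-1 *: e :: w).
    by rewrite scaleN1r; apply: basis_cons (spanvS F0 st') _ _ dQF => //; rewrite memvN.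
  rewrite -scaleN1r (osgn_cons_scale (orientP _) ewQ wF _ NewQ) ?oppr_eq0 ?oner_eq0 //.
  by rewrite ltr0_sgz ?oppr_lt0 ?ltr01 // mulN1r.
have inward_or (s' : kfaces X k) : pset s' `<=` Q -> is_facet F (pset s') ->
    inward_normal F (pset s') e \/ inward_normal F (pset s') (- e).
  move=> sQ [fF _]; have := facet_inward (face_subset fF) Fq e0.
  by rewrite spanv_side // => /(_ eQ eF dQF fF).
(* The cells are split by the side of the hyperplane on which they lie; those without inward normal
   [e] have inward normal [- e]. *)
rewrite [RHS](bigID (fun s' => `[< inward_normal F (pset s') e >])) /=.
under [X in _ = X + _]eq_bigl do rewrite -andbA.
rewrite (cell_side_sum ri e0 eQ eF).
have -> : \sum_(s' : kfaces X k | `[< pset s' `<=` Q >] && `[< is_facet F (pset s') >]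
      && ~~ `[< inward_normal F (pset s') e >])
      sgn_sub Q (ori s') (ori s) * sgn_facet F (ori t') (pset s') (ori s') =
    if `[< on_side q (- e) >] then osgn (ori t') w * osgn (ori s) (- e :: w) else 0.
  rewrite -(cell_side_sum ri Ne0 NeQ NeF); apply: eq_bigl => s'; rewrite -andbA.
  case: asboolP => //= sQ; case: asboolP => //= sF.
  have := inward_or _ sQ sF; have := @inward_normalN _ _ F (pset s') e F0.
  move=> /(_ (face_subset sF.1)) nn oo; apply/idP/idP => [/asboolPn|/asboolP] h.
    by apply/asboolP; case: oo.
  by apply/asboolPn => /nn.
(* If [Q] lay in the hyperplane, [e] would be orthogonal to the span of [Q], to which it belongs. *)
have side_or : on_side q e \/ on_side q (- e).
  apply: contrapT => /not_orP[h1 h2].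
  have : forall x, Q x -> dotv e x = dotv e q.
    move=> x Qx; apply/eqP; rewrite -subr_eq0 -dotvBr eq_le !leNgt.
    apply/andP; split; apply/negP => xq; first by apply: h1; exists x.
    by apply: h2; exists x; rewrite // dotvNl oppr_gt0.
  by move=> /(dotv_spanv Q0)/(_ eQ)/eqP; rewrite gt_eqF // dotvv_gt0.
(* With points on both sides the cell contributions are opposite, and a facet containing [F] would
   confine [Q] to one side. With one side only, the remaining cell and the facet contribute
   equally. *)
rewrite gN; case: asboolP => side; case: asboolP => Nside.
- rewrite mulrN subrr; apply: big_pred0 => t; apply/negP.
  move=> /andP[/asboolP[tQ _] /asboolP Ft].
  have tq := Ft _ Fq; have := facet_inward (face_subset tQ) tq e0 eQ.
  rewrite spanv_facet // => /(_ eF dQF tQ)[] [_ _ _ ge0].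
    by have [p Qp] := Nside; rewrite dotvNl oppr_gt0 ltNge ge0.
  by have [p Qp] := side; rewrite -oppr_lt0 -dotvNl ltNge ge0.
- by rewrite addr0 (facet_side_sum ri e0 eQ eF).
- by rewrite add0r -gN (facet_side_sum ri Ne0 NeQ NeF) // opprK.
- by case: side_or.
Qed.

End PositiveDimension.

Lemma sign_sum (k : int) (k0 : 0 <= k) (s : kfaces Y k) (t' : kfaces X (k - 1)) :
  \sum_(t : kfaces Y (k - 1) | `[< is_facet (pset t) (pset s) >] && `[< pset t' `<=` pset t >])
    sgn_facet (pset t) (ori t) (pset s) (ori s) * sgn_sub (pset t) (ori t') (ori t) =
  \sum_(s' : kfaces X k | `[< pset s' `<=` pset s >] && `[< is_facet (pset t') (pset s') >])
    sgn_sub (pset s) (ori s') (ori s) * sgn_facet (pset t') (ori t') (pset s') (ori s').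
Proof.
have [st'|nst'] := pselect (pset t' `<=` pset s); last first.
  rewrite !big_pred0 // => r; apply/negP => /andP[/asboolP h1 /asboolP h2]; apply: nst'.
    by apply: subset_trans h1; case: h2 => /face_subset.
  by apply: subset_trans h2 _; case: h1 => /face_subset.
have [k1|] := lerP 1 k; first exact: sign_sum_sub.
(* For [k = 0] the face [t'] is empty and [s] is a point, which is also a vertex of [X]; each sum
   has a single term and all signs are 1. *)
move=> k1; have kE : k = 0 by lia.
have t'0 : pset t' = set0 by apply: pdim_lt0; rewrite pset_dim kE.
have [t0 t00] : exists t0 : kfaces Y (k - 1), pset t0 = set0.
  by apply: kfaces_surj; [exact: face_set0|rewrite pdim_set0 kE].
have s0 : pset s !=set0 by apply: pdim_ge0; rewrite pset_dim.
have sing x y : pset s x -> pset s y -> x = y.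
  move=> sx sy; apply/subr0_eq/eqP; rewrite -memv0.
  suff <- : spanv (pset s) = 0%VS by exact: subr_mem_spanv.
  by apply/eqP; have := etrans (pset_dim s) kE; rewrite -dimv_eq0 pdimE // => -[->].
have [s1 s1s] : exists s1 : kfaces X k, pset s1 = pset s.
  have [_ /(_ _ (pset_mem s))[A AX sA] _] := refXY.
  have [x sx] := s0; move: (sx); rewrite {1}sA => -[P AP Px].
  suff PE : P = pset s by rewrite -PE; apply: kfaces_surj; [exact: AX|rewrite PE pset_dim].
  apply/seteqP; split=> [y Py|y sy]; first by rewrite sA; exists P.
  by rewrite -(sing _ _ sx sy).
have facet0 Z (r : kfaces Z k) : is_facet set0 (pset r).
  by split; [exact: is_face_set0|rewrite pdim_set0 pset_dim kE].
rewrite t'0 (big_pred1 t0) => [|t /=]; last first.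
  apply/andP/eqP => [[/asboolP[_ +] _]|->].
    rewrite pset_dim => tk; apply: pset_inj; rewrite t00.
    by apply: pdim_lt0; rewrite pset_dim kE.
  by rewrite t00; split; apply/asboolP => //; exact: facet0.
rewrite (big_pred1 s1) => [|r /=]; last first.
  apply/andP/eqP => [[/asboolP rs _]|->].
    have [x rx] : pset r !=set0 by apply: pdim_ge0; rewrite pset_dim.
    apply: pset_inj; rewrite s1s; apply/seteqP; split=> // y sy.
    by rewrite -(sing _ _ (rs _ rx) sy).
  by rewrite s1s; split; apply/asboolP => //; exact: facet0.
by rewrite /sgn_facet /sgn_sub t00 s1s pdim_set0 (etrans (pset_dim s) kE).
Qed.

End SignSum.

(** * Bundle maps on frames, and the morphism property *)

Section Bundles.
Variables (R : realType).
Local Notation C := R[i].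
Implicit Types (I J : finType).

Lemma frame_decomp I (f : fiber R I) : f = \sum_i (f i : C) *: frame R i.
Proof.
apply/ffunP => j; rewrite sum_ffunE (bigD1 j) //= big1 => [|i ij].
  by rewrite !ffunE eqxx addr0 [RHS]mulr1.
by rewrite !ffunE (negPf ij); exact: mulr0.
Qed.

Lemma sum_frameE I (P : pred I) (c : I -> C) j :
  (\sum_(i | P i) c i *: frame R i) j = if P j then c j else 0.
Proof.
rewrite sum_ffunE; case: ifPn => Pj.
  rewrite (bigD1 j) //= big1 => [|i /andP[_ ij]].
    by rewrite !ffunE eqxx addr0; exact: mulr1.
  by rewrite !ffunE (negPf ij); exact: mulr0.
apply: big1 => i Pi; rewrite !ffunE (_ : i == j = false); first exact: mulr0.
by apply: contraTF Pi => /eqP ->.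
Qed.

Lemma hom_frameP I J (f g : 'Hom(fiber R I, fiber R J)) :
  (forall i, f (frame R i) = g (frame R i)) -> f = g.
Proof.
move=> fg; apply/lfunP => u; rewrite [u]frame_decomp !linear_sum.
by apply: eq_bigr => i _; rewrite !linearZ /= fg.
Qed.

End Bundles.

Lemma holomorphic_refinement_map (R : realType) (d n : nat)
    (X Y : oriented_labeled_complex R d n) (k : int) :
  holomorphic_map (refinement_map X Y k).
Proof.
move=> s s' z.
have -> : (fun z => refinement_map X Y k z (frame R s) s') = fun z =>
    if `[< pset s' `<=` pset s >]
    then (sgn_sub (pset s) (orient (val s')) (orient (val s)))%:~R
      * mquot (flabel Y (pset s)) (flabel X (pset s')) z else 0.
  by rewrite funeqE => x; rewrite frame_mapE sum_frameE.
case: asboolP => _; last exact: differentiable_cst.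
by apply: differentiableM; [exact: differentiable_cst|exact: holomorphic_mquot].
Qed.

Theorem proposition5p2 (R : realType) (d n : nat)
    (X Y : oriented_labeled_complex R d n) (refXY : refines X Y) :
  (forall k : int, -1 <= k -> holomorphic_map (refinement_map X Y k)) /\
  (forall k : int, 0 <= k -> forall z : 'rV[R[i]]_n,
     (refinement_map X Y (k - 1) z \o boundary Y k z)%VF =
     (boundary X k z \o refinement_map X Y k z)%VF).
Proof.
split=> [k _|k k0 z]; first exact: holomorphic_refinement_map.
have [_ _ refL] := refXY.
apply: hom_frameP => s; rewrite !comp_lfunE !frame_mapE !linear_sum.
apply/ffunP => t'; rewrite !sum_ffunE.
(* Every path from [s] to [t'], through a facet [t] of [s] or through a cell [s'] in [s], carries
   this same monomial by [mquotM]; only the integer sums of signs remain to be compared. *)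
pose m := mquot (flabel Y (pset s)) (flabel X (pset t')) z.
transitivity (((\sum_(t : kfaces Y (k - 1) | `[< is_facet (pset t) (pset s) >]
      && `[< pset t' `<=` pset t >])
    sgn_facet (pset t) (orient (val t)) (pset s) (orient (val s))
    * sgn_sub (pset t) (orient (val t')) (orient (val t)))%:~R : R[i]) * m).
  rewrite rmorph_sum mulr_suml [RHS]big_mkcondr; apply: eq_bigr => t /asboolP [ts _].
  rewrite linearZ /= frame_mapE ffunE sum_frameE.
  case: ifPn => [/asboolP t't|_]; last exact: mulr0.
  rewrite rmorphM /m -(mquotM (m := flabel Y (pset s)) (m1 := flabel Y (pset t))
    (m2 := flabel X (pset t'))).
  - by rewrite [RHS]mulrACA.
  - by apply: flabel_mono (face_subset ts); exact: pset_mem.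
  - by apply: refL t't; exact: pset_mem.
rewrite (sign_sum refXY k0) rmorph_sum mulr_suml [LHS]big_mkcondr.
apply: eq_bigr => s' /asboolP s's.
rewrite linearZ /= frame_mapE ffunE sum_frameE.
case: ifPn => [/asboolP[ts' _]|_]; last exact/esym/mulr0.
rewrite rmorphM /m -(mquotM (m := flabel Y (pset s)) (m1 := flabel X (pset s'))
  (m2 := flabel X (pset t'))).
- by rewrite [LHS]mulrACA.
- by apply: refL s's; exact: pset_mem.
- by apply: flabel_mono (face_subset ts'); exact: pset_mem.
Qed.
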